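(* Let $p,q$ be positive integers with $\frac q2<p<q$. Let $r_2,\dots,r_n$ be nonnegative integers such that $$\sum_{i=2}^{n}\frac{2}{r_i+2}=\frac{p}{q-p}\quad\text{and}\quad r_i\ge\frac{4q-6p}{2p-q}\ \text{ for all } 2\le i\le n.$$ Let $G=N(H_0,H_{r_2},\dots,H_{r_n})$. Then $\mathrm{dep}(G)=\frac pq$.
   Context: For a connected graph $G$, $\tau(G)$ is the number of spanning trees of $G$, and for $e\in E(G)$, $\tau_G(e)$ is the number of spanning trees of $G$ containing $e$. The spanning tree edge density of $e$ is $d_G(e)=\tau_G(e)/\tau(G)$, and the spanning tree edge dependence of $G$ is $\mathrm{dep}(G)=\max_{e\in E(G)}d_G(e)$. Necklace graph: given vertex-disjoint connected graphs $G_1,\dots,G_n$ ($n\ge 2$) with a chosen edge $e_i=u_iv_i$ in each $G_i$, the necklace graph $N(G_1,\dots,G_n)$ is obtained from the disjoint union of the $G_i$ by identifying $v_i$ with $u_{i+1}$ for every $i$ (indices modulo $n$, so $v_n$ is identified with $u_1$). Distinct edges remain distinct edges. For an integer $r\ge 0$, $H_r$ is the graph consisting of two vertices $u,v$, the edge $uv$, and $r$ internally disjoint paths of length $2$ connecting $u$ and $v$ (so $H_0$ is the single edge $uv$). In $N(H_{r_1},\dots,H_{r_n})$ the chosen edge $e_i=u_iv_i$ of $H_{r_i}$ is the edge $uv$ of $H_{r_i}$. *)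

(* Defs.v *)
From HB Require Import structures.
From mathcomp Require Import all_boot all_order all_algebra.

Set Implicit Arguments.
Unset Strict Implicit.
Unset Printing Implicit Defensive.

Import Order.TTheory GRing.Theory Num.Theory.

(* Finite multigraphs: parallel edges are needed because gluing keeps distinct
   edges distinct. Edges are undirected; the order of the pair [ends e] is used
   only to name the two ends of a chosen edge. *)
Record mgraph := MGraph {
  vertex : finType;
  edge : finType;
  ends : edge -> vertex * vertex
}.

Section SpanningTrees.
Variable G : mgraph.
Implicit Types (F : {set edge G}) (e : edge G) (x y : vertex G).
Implicit Types (c : seq (vertex G * edge G)).

Definition joins e x y := (ends e == (x, y)) || (ends e == (y, x)).

Definition adj F x y := [exists e in F, joins e x y].

Definition connected F := [forall x, forall y, connect (adj F) x y].

(* [:: (x_1, e_1); ...; (x_k, e_k)] is a cycle of F when k > 0, the x_i are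
   distinct, the e_i are distinct edges of F, and e_i joins x_i to x_{i+1}
   (indices mod k). A loop is a cycle with k = 1, and two parallel edges form a
   cycle with k = 2. *)
Definition is_cycle F c :=
  [&& c != [::], uniq (unzip1 c), uniq (unzip2 c), all (mem F) (unzip2 c)
    & cycle (fun a b => joins a.2 a.1 b.1) c].

(* The bound on the length loses no cycle: see acyclicP. *)
Definition acyclic F :=
  [forall k : 'I_#|edge G|.+1, forall c : k.-tuple (vertex G * edge G),
     ~~ is_cycle F c].

Lemma acyclicP F : reflect (forall c, ~~ is_cycle F c) (acyclic F).
Proof.
apply: (iffP idP) => [/forallP acF c | acF]; last first.
  by apply/forallP=> k; apply/forallP=> c.
apply/negP=> cyc_c; have /and5P[_ _ Uc _ _] := cyc_c.
have le_c: size c < #|edge G|.+1.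
  by rewrite ltnS -(size_map snd) -(card_uniqP Uc) max_card.
by have /forallP/(_ (in_tuple c)) := acF (Ordinal le_c); rewrite cyc_c.
Qed.

Definition spanning_trees : {set {set edge G}} :=
  [set F : {set edge G} | connected F && acyclic F].

Definition tau : nat := #|spanning_trees|.

Definition tau_edge e : nat := #|[set F in spanning_trees | e \in F]|.

Definition density e : rat := ((tau_edge e)%:R / tau%:R)%R.

(* Densities are nonnegative, so the default value 0 does not affect the
   maximum as soon as G has an edge. *)
Definition dep : rat := \big[Num.max/0%R]_(e : edge G) density e.

End SpanningTrees.

Section Necklace.
Variables (n : nat) (G : 'I_n -> mgraph) (e : forall i, edge (G i)).

Definition necklace_pre : finType := {i : 'I_n & vertex (G i)}.

Definition left_end i : necklace_pre :=
  Tagged (fun i => vertex (G i)) (ends (e i)).1.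
Definition right_end i : necklace_pre :=
  Tagged (fun i => vertex (G i)) (ends (e i)).2.

(* [ordS i] is the cyclic successor of i in 'I_n. *)
Definition glue (a b : necklace_pre) :=
  [exists i, (a == right_end i) && (b == left_end (ordS i))].

Definition glue_equiv : rel necklace_pre :=
  connect (relU glue (fun a b => glue b a)).

Lemma glue_equiv_sym : symmetric glue_equiv.
Proof. by apply: sym_connect_sym => a b /=; rewrite orbC. Qed.

Canonical glue_equiv_rel :=
  EquivRel glue_equiv (@connect0 _ _) glue_equiv_sym (@connect_trans _ _).

(* [quot_type] is the identity; it carries the finType structure. *)
Definition necklace_vertex : finType :=
  quot_type {eq_quot glue_equiv_rel}%qT.

Definition necklace_class (a : necklace_pre) : necklace_vertex :=
  (\pi_({eq_quot glue_equiv_rel}) a)%qT.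

Definition necklace_edge : finType := {i : 'I_n & edge (G i)}.

Definition necklace_ends (f : necklace_edge) :
    necklace_vertex * necklace_vertex :=
  (necklace_class (Tagged (fun i => vertex (G i)) (ends (tagged f)).1),
   necklace_class (Tagged (fun i => vertex (G i)) (ends (tagged f)).2)).

(* The two ends u_i, v_i of the chosen edge e i are the components of
   [ends (e i)], in this order. *)
Definition necklace : mgraph := MGraph necklace_ends.

End Necklace.

(* graphH r is H_r: the vertices are u = inl false, v = inl true and the middle vertices
   inr j of the r paths; the edges are uv = None and the two edges
   Some (j, false), Some (j, true) joining inr j to u and to v. *)
Definition H_ends (r : nat) (f : option ('I_r * bool)) :
    (bool + 'I_r) * (bool + 'I_r) :=
  if f is Some (j, b) then (inl b, inr j) else (inl false, inl true).

Definition graphH (r : nat) : mgraph := MGraph (@H_ends r).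

Definition H_uv (r : nat) : edge (graphH r) := None.

Definition necklace_H (n : nat) (r : 'I_n -> nat) : mgraph :=
  necklace (fun i => H_uv (r i)).

(* Main.v *)
(* A spanning tree of the necklace restricts to a spanning tree of every bead
   but one, and to a two-component forest separating u from v in that one. Let
   x_i = 2 / (r_i + 2) be the ratio of the numbers of such forests and trees of
   H_{r_i}, and S = sum_i x_i = 1 + p / (q - p) = q / (q - p). Then tau is S
   times the product of the numbers of trees of the beads. An edge uv of bead i
   has density x_i (S - x_i) / S, which is 1 - 1 / S = p / q for i = 1, and an
   edge of a path of bead i has density
   (x_i / 2 + (1 / 2 + x_i / 4) (S - x_i)) / S. That these are at most
   (S - 1) / S amounts to (1 - x_i) (S - 1 - x_i) >= 0 and
   (2 - x_i) (S - 2 - x_i) >= 0; the hypothesis on r_i says x_i <= S - 2. *)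

Require Import Defs.
From mathcomp Require Import all_boot all_order all_algebra.
From mathcomp Require Import zify ring lra.
Import Order.TTheory GRing.Theory Num.Theory.
Local Open Scope ring_scope.

Set Implicit Arguments.
Unset Strict Implicit.
Unset Printing Implicit Defensive.

(** * Spanning trees as minimal connected edge sets *)

Section MinimalConnected.
Variable G : mgraph.
Implicit Types (F : {set edge G}) (e f : edge G) (x y z : vertex G).

Lemma adjP F x y : reflect (exists2 e, e \in F & joins e x y) (adj F x y).
Proof.
apply: (iffP existsP) => [[e /andP[]]|[e eF xy]]; exists e => //.
exact/andP.
Qed.

Lemma joinsC e x y : joins e x y = joins e y x.
Proof. by rewrite /joins orbC. Qed.

Lemma joins_ends e : joins e (ends e).1 (ends e).2.
Proof. by rewrite /joins -surjective_pairing eqxx. Qed.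

Lemma joinsP e x y :
  joins e x y -> (x, y) = ends e \/ (y, x) = ends e.
Proof. by case/orP=> /eqP->; [left | right]. Qed.

Lemma adj_sym F : symmetric (adj F).
Proof. by move=> x y; apply: eq_existsb => e; rewrite joinsC. Qed.

Lemma connect_adj_sym F : connect_sym (adj F).
Proof. exact/sym_connect_sym/adj_sym. Qed.

Lemma connectedP F : reflect (forall x y, connect (adj F) x y) (connected F).
Proof.
apply: (iffP forallP) => [cF x y | cF x]; first by have /forallP := cF x.
exact/forallP.
Qed.

Let step (a b : vertex G * edge G) := joins a.2 a.1 b.1.

(** Supplies the pairs that [is_cycle] expects along a simple path; [e] is the edge meant to close
    it. The edges are distinct because the first one meets [y], while the later ones have both ends
    among the later vertices. *)
Lemma uniq_path_edges F y p e :
  path (adj F) y p -> uniq (y :: p) ->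
  exists s, [/\ unzip1 (rcons s (last y p, e)) = y :: p,
    uniq (unzip2 s), {subset unzip2 s <= F},
    {in unzip2 s, forall f, ((ends f).1 \in y :: p) && ((ends f).2 \in y :: p)}
    & forall b, joins b.2 b.1 y -> path step b (rcons s (last y p, e))].
Proof.
elim: p y => [|z p IHp] y /= => [_ _|/andP[/adjP[f fF yz] pth] /andP[yp Up]].
  by exists [::]; split=> // b by_; rewrite /= andbT.
have [s [Es Us sF endsS pathS]] := IHp z pth Up.
exists ((y, f) :: s); split=> /=.
- by rewrite Es.
- rewrite Us andbT; apply: contraNN yp => /endsS.
  by case/joinsP: yz => <- /= /andP[].
- by move=> g; rewrite inE => /predU1P[->|/sF].
- move=> g; rewrite inE => /predU1P[->|/endsS/andP[h1 h2]].
    by case/joinsP: yz => <- /=; rewrite !inE !eqxx ?orbT.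
  by rewrite inE h1 orbT inE h2 orbT.
- by move=> b yb; rewrite [step _ _]yb pathS.
Qed.

(** The edge [b.2] leaving [b] need not lie in [F], so the connection starts only at its other end
    [z]. *)
Lemma path_connect F b s t :
  path step b (rcons s t) -> {subset unzip2 s <= F} ->
  exists2 z, joins b.2 b.1 z & connect (adj F) z t.1.
Proof.
elim: s b => [|d s IHs] b /=; first by rewrite andbT => bt _; exists t.1.
case/andP=> bd /IHs{}IHs sF.
have [|z dz zt] := IHs; first by move=> f fs; apply: sF; rewrite inE fs orbT.
exists d.1 => //; apply: connect_trans zt; apply/connect1/adjP.
by exists d.2 => //; apply: sF; rewrite mem_head.
Qed.

(** A simple path in [F :\ e] between the ends of [e] closes up with [e] to a cycle; conversely, the
    rest of a cycle through [e] is a detour that makes [e] redundant. *)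
Lemma spanning_tree_minimal F :
  reflect (connected F /\ {in F, forall e, ~~ connected (F :\ e)})
          (F \in spanning_trees G).
Proof.
rewrite inE; apply: (iffP andP) => [[cF /acyclicP acF] | [cF minF]]; split=> //.
  move=> e eF; apply/negP => /connectedP/(_ (ends e).2 (ends e).1)/connectP[p].
  case/shortenP=> {}p pth Up _ Elast.
  have [s [Es Us sF _ pathS]] := uniq_path_edges e pth Up.
  have /negP[] := acF ((last (ends e).2 p, e) :: s).
  have perm_s : perm_eq ((last (ends e).2 p, e) :: s)
                        (rcons s (last (ends e).2 p, e)).
    by rewrite perm_sym perm_rcons.
  apply/and5P; split=> //.
  - by rewrite (perm_uniq (perm_map fst perm_s)) [map _ _]Es.
  - by rewrite /= Us andbT; apply/negP=> /sF; rewrite !inE eqxx.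
  - by rewrite /= eF; apply/allP => f /sF; rewrite inE => /andP[].
  by rewrite /= pathS //= -Elast joins_ends.
apply/acyclicP=> -[|[x e] s] //; apply/negP => /and5P[_ _ /= /andP[es _]].
move=> /andP[eF /allP sF] /path_connect.
have sFe : {subset unzip2 s <= F :\ e}.
  by move=> f fs; rewrite !inE [f \in F]sF // andbT; apply: contraNneq es => <-.
case/(_ _ sFe) => z /= xz zx; have /negP[] := minF e eF.
apply/connectedP => a b; move/connectedP/(_ a b): cF; apply: connect_sub.
move=> {}a {}b /adjP[f fF ab].
have [Ef|nef] := eqVneq f e; last first.
  by apply/connect1/adjP; exists f; rewrite // !inE nef.
rewrite {f}Ef in fF ab; move: zx.
case/joinsP: xz ab => Exz /joinsP[]; rewrite -Exz => -[-> ->];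
  by rewrite // connect_adj_sym.
Qed.

(** A tool for refuting connectedness by a nonconstant colouring. *)
Lemma connected_invariant (T : Type) F (c : vertex G -> T) :
  connected F -> {in F, forall e, c (ends e).1 = c (ends e).2} ->
  forall x y, c x = c y.
Proof.
move=> /connectedP cF inv x y; have /connectP[p] := cF x y.
elim: p x => [|z p IHp] x /=; first by move=> _ ->.
case/andP=> /adjP[e eF xz] pth /(IHp _ pth) <-.
by have := inv e eF; case/joinsP: xz => <-.
Qed.

End MinimalConnected.

(** * Connectivity data of one bead *)

Notation edge_set r := {set option ('I_r * bool)}.

Section PartsOfH.
Variable r : nat.
Implicit Types A : edge_set r.

(** A middle vertex has only two edges, to the ends of its bead, so connectedness of the necklace
    depends on a bead only through this property and [links_ends]. *)
Definition hits_paths A :=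
  [forall j, (Some (j, false) \in A) || (Some (j, true) \in A)].

Definition links_ends A :=
  (None \in A) || [exists j, (Some (j, false) \in A) && (Some (j, true) \in A)].

Lemma hits_pathsP A :
  reflect (forall j, (Some (j, false) \in A) || (Some (j, true) \in A))
          (hits_paths A).
Proof. exact: forallP. Qed.

Lemma links_endsP A :
  reflect (None \in A \/
           exists2 j, Some (j, false) \in A & Some (j, true) \in A)
          (links_ends A).
Proof.
apply: (iffP orP) => -[A0|]; [by left | | by left |].
  by case/existsP=> j /andP[]; right; exists j.
by case=> j jf jt; right; apply/existsP; exists j; apply/andP.
Qed.

End PartsOfH.

(** * Connected edge sets of the necklace *)

Section NecklaceConnected.
Variables (n : nat) (r : 'I_n -> nat).
Let N := necklace_H r.
Implicit Types (F : {set edge N}) (i k m : 'I_n).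

Definition necklace_e i (x : option ('I_(r i) * bool)) : edge N :=
  Tagged (fun i => edge (graphH (r i))) x.

Definition necklace_v i (w : bool + 'I_(r i)) : vertex N :=
  necklace_class (fun i => H_uv (r i))
    (Tagged (fun i => vertex (graphH (r i))) w).

Definition part F i : edge_set (r i) :=
  [set x | necklace_e x \in F].

Lemma necklace_v_surj (x : vertex N) : exists i w, x = @necklace_v i w.
Proof.
exists (tag (repr x)), (tagged (repr x)).
by rewrite /necklace_v /necklace_class taggedK reprK.
Qed.

Lemma necklace_v_glue i :
  necklace_v (inl true : _ + 'I_(r i)) =
  necklace_v (inl false : _ + 'I_(r (ordS i))).
Proof.
apply/eqmodP/connect1/orP; left; apply/existsP; exists i.
by rewrite !eqxx.
Qed.

Lemma necklace_endsE i (x : option ('I_(r i) * bool)) :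
  ends (necklace_e x) = (necklace_v (H_ends x).1, necklace_v (H_ends x).2).
Proof. by []. Qed.

Lemma adj_part F i (x : option ('I_(r i) * bool)) :
  x \in part F i -> adj F (necklace_v (H_ends x).1) (necklace_v (H_ends x).2).
Proof.
rewrite inE => xF; apply/adjP; exists (necklace_e x) => //.
by rewrite /joins necklace_endsE eqxx.
Qed.

(** Colours are chosen bead by bead and must agree only at glued ends; the quotient is dealt with
    here once, by reading the colour at a representative. *)
Lemma connected_coloring F (c : forall i, bool + 'I_(r i) -> bool) :
  connected F -> (forall i, c i (inl true) = c (ordS i) (inl false)) ->
  (forall i, {in part F i, forall x, c i (H_ends x).1 = c i (H_ends x).2}) ->
  forall i k w w', c i w = c k w'.
Proof.
move=> cF c_glue c_edge.
pose d (a : necklace_pre (fun i => graphH (r i))) := c (tag a) (tagged a).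
have d_equiv a b : glue_equiv (fun i => H_uv (r i)) a b -> d a = d b.
  move/connectP=> [p]; elim: p a => [|a' p IHp] a /=; first by move=> _ ->.
  case/andP=> aa' pth /(IHp _ pth) <-.
  by case/orP: aa' => /existsP[i /andP[/eqP-> /eqP->]]; rewrite /d /= c_glue.
have dE i w : d (repr (@necklace_v i w)) = c i w.
  have -> : c i w = d (Tagged (fun i => vertex (graphH (r i))) w) by [].
  by apply/d_equiv/eqmodP; rewrite reprK.
move=> i k w w'; rewrite -(dE i w) -(dE k w').
apply: (@connected_invariant N _ F (fun x => d (repr x))) => // -[m x] xF.
by rewrite (necklace_endsE x) !dE c_edge // inE.
Qed.

Lemma connected_hits F i : connected F -> hits_paths (part F i).
Proof.
move=> cF; apply/hits_pathsP=> j; apply/negPn/negP; rewrite negb_or.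
case/andP=> jf jt.
(* Only the middle vertex [j] of bead [i] is coloured [true]; the comparison is made in the tagged
   type because [j'] may belong to another bead. *)
pose c m (w : bool + 'I_(r m)) :=
  if w is inr j' then Tagged (fun m => 'I_(r m)) j' ==
                      Tagged (fun m => 'I_(r m)) j :> {m : 'I_n & 'I_(r m)}
  else false.
suff: c i (inr j) = c i (inl true) by rewrite /c eqxx.
apply: (connected_coloring cF) => // m [[j' b]|] //= xF.
apply/esym/negP => /eqP Ej; move: xF; rewrite inE.
have := congr1 (fun t : {m : 'I_n & 'I_(r m)} =>
  @necklace_e (tag t) (Some (tagged t, b))) Ej.
by rewrite /= => ->; apply/negP; move: jf jt; rewrite !inE; case: b.
Qed.

(** Two beads with unlinked ends would cut the ring into two arcs. *)
Lemma connected_links F i k :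
  connected F -> ~~ links_ends (part F i) -> ~~ links_ends (part F k) -> i = k.
Proof.
move=> cF.
wlog le_ik : i k / (i <= k)%N => [wlg|].
  by case/orP: (leq_total i k) => /wlg h *; [|apply/esym]; apply: h.
move=> Li Lk; apply/val_inj/eqP; rewrite eqn_leq le_ik leqNgt.
apply/negP=> lt_ik.
(* [u_m] and [v_m] are coloured by the arc from [v_i] to [u_k], and a middle
   vertex by the end to which it is attached. *)
pose c m (w : bool + 'I_(r m)) := match w with
  | inl false => (i < m <= k)%N
  | inl true => (i <= m < k)%N
  | inr j => if Some (j, true) \in part F m then (i <= m < k)%N
             else (i < m <= k)%N end.
(* A linked bead is neither [i] nor [k], so strict and weak comparisons agree and its two ends get
   the same colour. *)
have c_link m : links_ends (part F m) -> (i <= m < k)%N = (i < m <= k)%N.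
  move=> Lm; rewrite [(i <= m)%N]leq_eqVlt [(m <= k)%N]leq_eqVlt !val_eqE.
  have /negPf-> : i != m by apply: contraTneq Lm => <-.
  by have /negPf-> : m != k by apply: contraTneq Lm => ->.
suff: c i (inl false) = c k (inl false).
  by rewrite /= ltnn leqnn lt_ik.
apply: (connected_coloring cF) => [m|m [[j []]|] xF] /=.
(* At the wrap-around from bead [n - 1] to bead 0 both colours are [false]. *)
- have [lt_m|ge_m] := ltnP m.+1 n; first by rewrite modn_small.
  have -> : m.+1 = n by apply/eqP; rewrite eqn_leq ge_m ltn_ord.
  by rewrite modnn [(n <= k)%N]leqNgt ltn_ord andbF.
- by rewrite xF.
- case: ifP => // jt; rewrite c_link //.
  by apply/links_endsP; right; exists j.
- by rewrite c_link //; apply/links_endsP; left.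
Qed.

Lemma connected_necklaceP F :
  (0 < n)%N -> reflect
  ((forall i, hits_paths (part F i)) /\
   (forall i k, ~~ links_ends (part F i) -> ~~ links_ends (part F k) -> i = k))
  (connected F).
Proof.
move=> n_gt0; apply: (iffP idP) => [cF | [hitF linkF]].
  by split=> [i | i k]; [apply: connected_hits | apply: connected_links].
(* [i0] is the unlinked bead if there is one, and bead 0 otherwise. *)
have [i0 linked] : exists i0, forall i, i != i0 -> links_ends (part F i).
  have [/existsP[i0 Ni0]|] := boolP [exists i, ~~ links_ends (part F i)].
    by exists i0 => i; apply: contraNT => /linkF/(_ Ni0)/eqP.
  rewrite negb_exists => /forallP all_linked.
  by exists (Ordinal n_gt0) => i _; rewrite -[links_ends _]negbK.
pose u i : vertex N := necklace_v (inl false : _ + 'I_(r i)).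
pose v i : vertex N := necklace_v (inl true : _ + 'I_(r i)).
have cS := connect_adj_sym F.
have uv i : i != i0 -> connect (adj F) (u i) (v i).
  move=> /linked/links_endsP[xF|[j jf jt]]; first exact/connect1/(adj_part xF).
  apply: connect_trans (connect1 (adj_part jf)) _.
  by rewrite cS; apply: connect1 (adj_part jt).
have vuS i : v i = u (ordS i) by apply: necklace_v_glue.
(* Up to [i0], walk forward from [u_0]; beyond [i0], walk forward from [u_m] until the ring closes
   at [u_0]. Bead [i0] is never crossed. *)
have uu0 m : connect (adj F) (u (Ordinal n_gt0)) (u m).
  have [le_m|lt_m] := leqP m i0.
    case: m le_m => m lt_mn /=; elim: m lt_mn => [|m IHm] lt_mn lt_mi.
      by apply: eq_connect0; congr u; apply: val_inj.
    apply: connect_trans (IHm (ltnW lt_mn) (ltnW lt_mi)) _.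
    have -> : Ordinal lt_mn = ordS (Ordinal (ltnW lt_mn)).
      by apply: val_inj; rewrite /= modn_small.
    by rewrite -vuS; apply: uv; rewrite -val_eqE /= neq_ltn lt_mi.
  rewrite cS; have [d] := ubnP (n - m)%N.
  elim: d m lt_m => // d IHd m lt_m lt_d.
  apply: connect_trans (uv m _) _; first by rewrite -val_eqE neq_ltn lt_m orbT.
  rewrite vuS; have [lt_mn|ge_mn] := ltnP m.+1 n.
    apply: IHd; rewrite /= modn_small //; first exact: ltnW.
    by rewrite subnS prednK ?subn_gt0.
  apply: eq_connect0; congr u; apply: val_inj => /=.
  suff -> : m.+1 = n by rewrite modnn.
  by apply/eqP; rewrite eqn_leq ge_mn ltn_ord.
have uu i k : connect (adj F) (u i) (u k).
  by apply: connect_trans (uu0 k); rewrite cS.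
suff wu x : exists i, connect (adj F) x (u i).
  apply/connectedP => x y; have [i xi] := wu x; have [k yk] := wu y.
  by apply: connect_trans xi _; apply: connect_trans (uu i k) _; rewrite cS.
have [i [[[]|j] ->]] := necklace_v_surj x.
- by exists (ordS i); rewrite -vuS.
- by exists i.
have /hits_pathsP/(_ j)/orP[jF|jF] := hitF i.
  by exists i; rewrite cS; apply: connect1 (adj_part jF).
by exists (ordS i); rewrite -vuS cS; apply: connect1 (adj_part jF).
Qed.

End NecklaceConnected.

(** * Two counting principles *)

Lemma card_unique_witness (I T : finType) (R : I -> pred T) :
  (forall i k x, R i x -> R k x -> i = k) ->
  #|[set x | [exists i, R i x]]| = (\sum_i #|[set x | R i x]|)%N.
Proof.
move=> uniqR; under [RHS]eq_bigr => i _ do rewrite -sum1_card big_mkcond.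
rewrite exchange_big -sum1_card big_mkcond; apply: eq_bigr => x _ /=.
rewrite inE; under [RHS]eq_bigr => i _ do rewrite inE.
case: existsP => [[i Rix]|noR]; last first.
  by rewrite big1 // => i _; case: ifP => // Rix; case: noR; exists i.
rewrite (bigD1 i) //= Rix big1 // => k; apply: contraNeq.
by case: ifP => // Rkx _; rewrite (uniqR _ _ _ Rkx Rix).
Qed.

Lemma card_set_parts (I : finType) (T : I -> finType)
    (X : forall i, {set {set T i}}) :
  #|[set F : {set {i : I & T i}} |
      [forall i, [set x | Tagged T x \in F] \in X i]]| = (\prod_i #|X i|)%N.
Proof.
pose join (f : {dffun forall i, {set T i}}) : {set {i : I & T i}} :=
  [set x | tagged x \in f (tag x)].
have part_join f i : [set x | Tagged T x \in join f] = f i.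
  by apply/setP => x; rewrite !inE.
rewrite -cardsXn -(card_imset (f := join)) => [|f g Efg]; last first.
  by apply/ffunP => i; rewrite -!part_join Efg.
apply: eq_card => F; rewrite inE.
apply/forallP/imsetP => [FX | [f /setXnP fX ->] i].
  pose f : {dffun forall i, {set T i}} :=
    [ffun i => [set x | Tagged T x \in F]].
  exists f; first by apply/setXnP => i; rewrite ffunE FX.
  by apply/setP => -[i x]; rewrite inE ffunE /= inE.
by rewrite part_join fX.
Qed.

(** * Counting forests and trees of a bead *)

Section CountsInH.
Variable r : nat.
Implicit Types (A : edge_set r) (l : option 'I_r).

(* Spanning forests of [H_r] with two components, one containing [u] and the
   other [v]. *)
Definition bead_forest : {set edge_set r} :=
  [set A | hits_paths A && ~~ links_ends A].

(** The spanning trees of [graphH r] as minimal connected sets, connectedness of the bead being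
    [hits_paths] together with [links_ends]. *)
Definition bead_tree : {set edge_set r} :=
  [set A | [&& hits_paths A, links_ends A &
    [forall x in A, ~~ (hits_paths (A :\ x) && links_ends (A :\ x))]]].

Definition path_state A (j : 'I_r) :=
  (Some (j, false) \in A, Some (j, true) \in A).

(** An edge set amounts to a bit for [uv] and an independent state for each path. *)
Lemma card_states (b0 : bool) (Q : 'I_r -> pred (bool * bool)) :
  #|[set A : edge_set r | ((None \in A) == b0) &&
      [forall j, Q j (path_state A j)]]| =
  (\prod_j #|Q j|)%N.
Proof.
pose join (f : {ffun 'I_r -> bool * bool}) : edge_set r :=
  [set x | if x is Some (j, b) then if b then (f j).2 else (f j).1 else b0].
have state_join f j : path_state (join f) j = f j.
  by rewrite /path_state !inE -surjective_pairing.
transitivity #|family Q|; last by rewrite card_family foldrE big_map big_enum.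
rewrite -(card_imset (f := join)) => [|f g Efg]; last first.
  by apply/ffunP => j; rewrite -!state_join Efg.
apply: eq_card => A; rewrite inE; apply/andP/imsetP => [[/eqP A0 /forallP AQ]|].
  exists [ffun j => path_state A j].
    by apply/familyP => j; rewrite ffunE; apply: AQ.
  by apply/setP => -[[j []]|]; rewrite inE ?ffunE.
case=> f /familyP fQ ->; split; first by rewrite inE.
by apply/forallP => j; rewrite state_join; apply: fQ.
Qed.

Lemma card_bool2 (P : pred (bool * bool)) :
  #|P| = (P (true, true) + P (true, false) + P (false, true) +
          P (false, false))%N.
Proof.
transitivity (\sum_a \sum_b P (a, b))%N; last by rewrite !big_bool /= addnA.
rewrite pair_bigA -sum1_card big_mkcond; apply: eq_bigr => -[a b] _ /=.
by rewrite unfold_in; case: (P _).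
Qed.

(** Paths in [S] have a forced state, the others two choices; the multiplicative form avoids
    truncated subtraction in [2 ^ (r - #|S|)]. *)
Lemma prod_one_two (S : {set 'I_r}) :
  (2 ^ #|S| * \prod_j (if j \in S then 1 else 2) = 2 ^ r)%N.
Proof.
rewrite -prod_nat_const big_mkcond -big_split.
rewrite -[in RHS](card_ord r) -prod_nat_const /=.
by apply: eq_bigr => j _; case: ifP.
Qed.

(** Hitting gives at least one edge on each path, not linking at most one. *)
Lemma bead_forestE :
  bead_forest = [set A : edge_set r | ((None \in A) == false) &&
    [forall j, (path_state A j).1 (+) (path_state A j).2]].
Proof.
apply/setP => A.
rewrite !inE /path_state /links_ends negb_or negb_exists eqbF_neg.
rewrite andbCA; congr (_ && _).
apply/andP/forallP => [[/hits_pathsP hA /forallP lA] j|stA].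
  by have := hA j; have := lA j; do 2!case: (_ \in A).
by split; [apply/hits_pathsP|apply/forallP] => j;
  have := stA j => /=; do 2!case: (_ \in A).
Qed.

(* In a tree, [u] and [v] are linked by the edge [uv] ([l = None]) or by the
   path through the middle vertex [j] ([l = Some j]); every other path is
   hit exactly once. *)
Definition linked_by l A := ((None \in A) == (l == None)) &&
  [forall j, if l == Some j then (path_state A j).1 && (path_state A j).2
             else (path_state A j).1 (+) (path_state A j).2].

Lemma linked_by_inj l l' A : linked_by l A -> linked_by l' A -> l = l'.
Proof.
move=> /andP[/eqP A0 /forallP stA] /andP[/eqP]; rewrite A0.
case: l => [j|] in A0 stA *; case: l' => [j'|] //= _ /forallP/(_ j).
by have := stA j; rewrite eqxx => /andP[/= -> ->]; case: eqP => // ->.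
Qed.

Lemma bead_treeE : bead_tree = [set A | [exists l, linked_by l A]].
Proof.
apply/setP => A; rewrite !inE; apply/and3P/existsP.
  case=> /hits_pathsP hA lA /'forall_implyP minA.
  have minP x : x \in A -> hits_paths (A :\ x) -> ~~ links_ends (A :\ x).
    by move=> /minA; rewrite negb_and => /orP[/negPf->|].
  (* Dropping one edge of a complete path keeps every middle vertex hit, so by minimality it must
     destroy the link: no second link exists. *)
  have both_min j : Some (j, false) \in A -> Some (j, true) \in A ->
      ~~ links_ends (A :\ Some (j, true)).
    move=> jf jt; apply: minP => //; apply/hits_pathsP => j'; rewrite !inE /=.
    have [->|nj] := eqVneq j' j.
      by rewrite jf andbT; apply/orP; left; apply/eqP; case.
    have ne b : Some (j', b) != Some (j, true) by apply: contraNneq nj => -[->].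
    by rewrite !ne hA.
  have [A0|nA0] := boolP (None \in A).
    exists None; rewrite /linked_by A0 /=; apply/forallP => j.
    have := hA j; have := both_min j; do 2!case: (_ \in A) => //=.
    by case/(_ _ _)/negP => //; apply/links_endsP; left; rewrite !inE.
  case/links_endsP: lA => [|[k kf kt]]; first by rewrite (negPf nA0).
  exists (Some k); rewrite /linked_by (negPf nA0) /=; apply/forallP => j.
  have [[<-]|nkj] := eqVneq; first by rewrite kf kt.
  have := hA j; have := both_min j; do 2!case: (_ \in A) => //=.
  case/(_ _ _)/negP => //; apply/links_endsP; right.
  by exists k; rewrite !inE ?kf ?kt ?andbT //; apply: contraNneq nkj => -[->].
case=> l /andP[/eqP A0 /forallP stA]; split.
- apply/hits_pathsP => j; have := stA j.
  by case: ifP => _ /=; do 2!case: (_ \in A).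
- apply/links_endsP; case: l => [j|] in A0 stA *; last by left; rewrite A0.
  by right; exists j; have := stA j; rewrite eqxx => /andP[].
apply/'forall_implyP => x xA; apply/negP => /andP[/hits_pathsP hA lA].
(* Path [l] is the only one that can be complete, so deleting [x] either isolates a middle vertex or
   destroys the only link. *)
have linkE j : Some (j, false) \in A -> Some (j, true) \in A -> l = Some j.
  by move=> jf jt; have := stA j; rewrite /= jf jt; case: eqP.
case: x xA hA lA => [[j b] jA hA|nA _] /links_endsP[].
- rewrite !inE A0 => /eqP l0; have := hA j; rewrite !inE l0 in linkE *.
  by case: b jA {hA} => jA; rewrite eqxx ?orbF /= => /andP[_ jA'];
    have := linkE j; rewrite jA jA' => /(_ isT isT).
- case=> j'; rewrite !inE => /andP[n'f j'f] /andP[n't j't].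
  have := linkE _ j'f j't; have := hA j; rewrite !inE.
  case: b jA n'f n't {hA} => jA n'f n't; rewrite eqxx ?orbF => /andP[_ jA'];
    have := linkE j; rewrite jA jA' => /(_ isT isT) -> [Ej];
    by rewrite Ej eqxx in n'f n't.
- by rewrite !inE.
case=> j; rewrite !inE => /= jf jt; have := linkE _ jf jt.
by move=> lj; move: A0; rewrite nA lj.
Qed.


Lemma card_states_edge (b0 : bool) (Q : 'I_r -> pred (bool * bool)) j b :
  #|[set A : edge_set r | ((None \in A) == b0) &&
      [forall k, Q k (path_state A k)] && (Some (j, b) \in A)]| =
  (\prod_k #|[pred s | Q k s & (k == j) ==> (if b then s.2 else s.1)]|)%N.
Proof.
rewrite -(card_states b0 (fun k => [pred s | Q k s & _])).
apply: eq_card => A; rewrite !inE -andbA; congr (_ && _).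
apply/andP/forallP => [[/forallP QA jA] k|QA].
  by rewrite /= QA; apply/implyP => /eqP->; case: b jA.
split; first by apply/forallP => k; case/andP: (QA k).
by have /andP[_] := QA j; rewrite eqxx /=; case: b {QA}.
Qed.

Lemma card_bead_forest : #|bead_forest| = (2 ^ r)%N.
Proof.
rewrite bead_forestE (card_states false (fun _ s => s.1 (+) s.2)).
by under eq_bigr do rewrite card_bool2; rewrite prod_nat_const card_ord.
Qed.

Lemma card_bead_forest_uv : #|[set A in bead_forest | None \in A]| = 0%N.
Proof.
apply: eq_card0 => A; rewrite bead_forestE !inE; case: (_ \in A) => //.
by rewrite andbF.
Qed.

Lemma card_bead_forest_edge j b :
  (2 * #|[set A in bead_forest | Some (j, b) \in A]| = 2 ^ r)%N.
Proof.
rewrite -(prod_one_two [set j]) cards1; congr (_ * _)%N.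
transitivity (\prod_k #|[pred s : bool * bool |
    s.1 (+) s.2 & (k == j) ==> (if b then s.2 else s.1)]|)%N.
  rewrite -(card_states_edge false (fun _ s => s.1 (+) s.2)) bead_forestE.
  by apply: eq_card => A; rewrite !inE.
by apply: eq_bigr => k _; rewrite card_bool2 !inE /=; case: eqP => _; case: b.
Qed.

(** The exponent counts the paths with forced state: none for [l = None], one otherwise. *)
Lemma card_linked_by l :
  (2 ^ #|[set k | l == Some k]| * #|[set A | linked_by l A]| = 2 ^ r)%N.
Proof.
rewrite -[RHS](prod_one_two [set k | l == Some k]); congr (_ * _)%N.
rewrite (card_states (l == None)
  (fun k s => if l == Some k then s.1 && s.2 else s.1 (+) s.2)).
by apply: eq_bigr => k _; rewrite card_bool2 !inE /=; case: eqP.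
Qed.

Lemma card_linked_by_uv : #|[set A | linked_by None A]| = (2 ^ r)%N.
Proof.
rewrite -(card_linked_by None) (_ : [set k | None == Some k] = set0).
  by rewrite cards0 mul1n.
by apply/setP => k; rewrite !inE.
Qed.

(** The states of path [j] and of the linking path are forced; the union counts them once if they
    coincide. *)
Lemma card_linked_by_edge l j b :
  (2 ^ #|j |: [set k | l == Some k]| *
   #|[set A | linked_by l A && (Some (j, b) \in A)]| = 2 ^ r)%N.
Proof.
rewrite -[RHS](prod_one_two (j |: [set k | l == Some k])); congr (_ * _)%N.
rewrite (card_states_edge (l == None)
  (fun k s => if l == Some k then s.1 && s.2 else s.1 (+) s.2)).
apply: eq_bigr => k _; rewrite card_bool2 !inE /=.
by do 2!case: eqP => _; case: b.
Qed.

Lemma card_bead_tree_uv : #|[set A in bead_tree | None \in A]| = (2 ^ r)%N.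
Proof.
rewrite -card_linked_by_uv; apply: eq_card => A; rewrite bead_treeE !inE.
apply/andP/idP.
  by case=> /existsP[[k|] // lA] A0; case/andP: lA; rewrite A0.
by move=> lA; split; [apply/existsP; exists None | case/andP: lA => /eqP].
Qed.

Lemma sum_option (T : finType) (f : option T -> nat) :
  (\sum_l f l = f None + \sum_k f (Some k))%N.
Proof.
rewrite (bigD1 None) //=; congr (_ + _)%N.
rewrite (reindex_omap Some id) => [|[]//]; apply: eq_bigl => k.
by rewrite eqxx.
Qed.

(** [2 ^ r] trees use [uv], and each of the [r] paths is the link in half as many. *)
Lemma card_bead_tree : (2 * #|bead_tree| = (r + 2) * 2 ^ r)%N.
Proof.
rewrite bead_treeE card_unique_witness; last exact: linked_by_inj.
rewrite sum_option mulnDr big_distrr /=.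
rewrite card_linked_by_uv addnC mulnDl; congr (_ + _)%N.
rewrite -[X in _ = (X * _)%N]card_ord -sum_nat_const; apply: eq_bigr => k _.
rewrite -(card_linked_by (Some k)).
rewrite (_ : [set k' | Some k == Some k'] = [set k]) ?cards1 //.
by apply/setP => k'; rewrite !inE eq_sym.
Qed.

(** After multiplication by 4, the links [uv] and path [j] contribute [2 * 2 ^ r] each, and every
    other path [2 ^ r]. *)
Lemma card_bead_tree_edge j b :
  (4 * #|[set A in bead_tree | Some (j, b) \in A]| = (r + 3) * 2 ^ r)%N.
Proof.
rewrite (_ : [set A in _ | _] =
    [set A | [exists l, linked_by l A && (Some (j, b) \in A)]]); last first.
  apply/setP => A; rewrite bead_treeE !inE; apply/andP/existsP.
    by case=> /existsP[l lA] jA; exists l; apply/andP.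
  by case=> l /andP[lA jA]; split=> //; apply/existsP; exists l.
rewrite card_unique_witness; last first.
  by move=> l l' A /andP[lA _] /andP[/(linked_by_inj lA)].
rewrite sum_option mulnDr big_distrr /=.
have -> : (4 * #|[set A | linked_by None A && (Some (j, b) \in A)]| =
    2 * 2 ^ r)%N.
  rewrite -(card_linked_by_edge None j b) (_ : _ |: _ = [set j]).
    by rewrite cards1 mulnA.
  by apply/setP => k; rewrite !inE orbF.
rewrite (eq_bigr (fun k => 2 ^ r + (k == j) * 2 ^ r)%N) => [|k _]; last first.
  rewrite -(card_linked_by_edge (Some k) j b).
  rewrite (_ : [set k' | Some k == Some k'] = [set k]).
    rewrite cardsU1 cards1 inE [j == k]eq_sym.
    by case: (k == j); rewrite /= ?mulSn; lia.
  by apply/setP => k'; rewrite !inE eq_sym.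
rewrite big_split /= sum_nat_const card_ord (bigD1 j) //= eqxx mul1n big1.
  lia.
by move=> k /negPf->.
Qed.

End CountsInH.

(** * Spanning trees of the necklace *)

Lemma bead_forest_minimal r (A : edge_set r) x :
  A \in bead_forest r -> x \in A -> ~~ hits_paths (A :\ x).
Proof.
rewrite bead_forestE !inE eqbF_neg => /andP[A0 /forallP stA].
case: x => [[j b] jA|]; last by rewrite (negPf A0).
apply/negP => /hits_pathsP/(_ j); have := stA j; rewrite /path_state !inE /=.
by case: b jA => ->; rewrite eqxx ?addbT ?orbF => /negPf-> //; rewrite andbF.
Qed.

(** Serves to exclude a tree with all beads linked: opening one bead at such an edge [x] would leave
    the necklace connected. *)
Lemma links_ends_remove r (A : edge_set r) :
  hits_paths A -> links_ends A -> exists2 x, x \in A & hits_paths (A :\ x).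
Proof.
move=> /hits_pathsP hA /links_endsP[A0|[j jf jt]].
  by exists None => //; apply/hits_pathsP => j; rewrite !inE hA.
exists (Some (j, true)) => //; apply/hits_pathsP => j'; rewrite !inE /=.
have [->|nj] := eqVneq j' j.
  by rewrite jf andbT; apply/orP; left; apply/eqP; case.
have ne b : Some (j', b) != Some (j, true) by apply: contraNneq nj => -[->].
by rewrite !ne hA.
Qed.

Section NecklaceTrees.
Variables (n : nat) (r : 'I_n -> nat).
Hypothesis n_gt0 : (0 < n)%N.
Let N := necklace_H r.
Implicit Types (F : {set edge N}) (i k : 'I_n).

Lemma part_remove F i (x : option ('I_(r i) * bool)) :
  part (F :\ necklace_e x) i = part F i :\ x.
Proof. by apply/setP => y; rewrite !inE /necklace_e eq_Tagged. Qed.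

Lemma part_remove_other F i k (x : option ('I_(r i) * bool)) :
  k != i -> part (F :\ necklace_e x) k = part F k.
Proof.
move=> nki; apply/setP => y; rewrite !inE.
suff -> : necklace_e y != necklace_e x by [].
by apply: contraNneq nki => /(congr1 tag) /= ->.
Qed.

Definition bead i0 i : {set edge_set (r i)} :=
  if i == i0 then bead_forest (r i) else bead_tree (r i).

Lemma necklace_treeP F :
  reflect (exists i0, forall i, part F i \in bead i0 i)
          (F \in spanning_trees N).
Proof.
apply: (iffP (spanning_tree_minimal _)).
  case=> /(connected_necklaceP _ n_gt0)[hitF linkF] minF.
  have minP i x : x \in part F i -> hits_paths (part F i :\ x) ->
      links_ends (part F i :\ x) \/
        (forall k, k != i -> links_ends (part F k)) ->
      False.
    rewrite inE => xF hx lx; have /negP[] := minF _ xF.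
    apply/(connected_necklaceP _ n_gt0); split=> [k|k k'].
      have [->|nki] := eqVneq k i; first by rewrite part_remove.
      by rewrite part_remove_other.
    case: lx => [lx|linked].
      have linksW m : ~~ links_ends (part (F :\ necklace_e x) m) ->
          ~~ links_ends (part F m).
        have [->|nmi] := eqVneq m i; first by rewrite part_remove lx.
        by rewrite part_remove_other.
      by move=> /linksW Nk /linksW; apply: linkF.
    have Ni m : ~~ links_ends (part (F :\ necklace_e x) m) -> m = i.
      by apply: contraNeq => nmi; rewrite part_remove_other ?linked.
    by move=> /Ni-> /Ni->.
  have [/existsP[i0 Ni0]|] := boolP [exists i, ~~ links_ends (part F i)].
    exists i0 => i; rewrite /bead; have [->|ni] := eqVneq i i0.
      by rewrite inE hitF.
    rewrite inE hitF /=; apply/andP; split.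
      by apply: contraNT ni => /linkF/(_ Ni0)/eqP.
    apply/'forall_implyP => x xF; apply/negP => /andP[hx lx].
    by apply: minP xF hx _; left.
  rewrite negb_exists => /forallP linked.
  have links i : links_ends (part F i) by rewrite -[links_ends _]negbK.
  have [x xF hx] := links_ends_remove (hitF (Ordinal n_gt0)) (links _).
  by case: (minP _ _ xF hx); right.
case=> i0 FP.
have forest0 : part F i0 \in bead_forest (r i0).
  by have := FP i0; rewrite /bead eqxx.
have treeP i : i != i0 -> part F i \in bead_tree (r i).
  by move=> /negPf ni; have := FP i; rewrite /bead ni.
split.
  apply/(connected_necklaceP _ n_gt0); split=> [i|i k].
    have [->|/treeP] := eqVneq i i0; last by rewrite inE => /and3P[].
    by move: forest0; rewrite inE => /andP[].
  have Ni m : ~~ links_ends (part F m) -> m = i0.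
    by apply: contraNeq => /treeP; rewrite inE => /and3P[].
  by move=> /Ni-> /Ni->.
move=> [i x] xF; apply/negP => /(connected_necklaceP _ n_gt0)[hitx linkx].
have {}xF : x \in part F i by rewrite inE.
(* In bead [i0] deletion isolates a middle vertex; in another bead it may instead unlink the ends,
   giving a second unlinked bead besides [i0]. *)
have := hitx i; have := linkx i i0; rewrite (@part_remove F i x) => link_i hx.
have [Ei|ni] := eqVneq i i0.
  subst i0; by have := bead_forest_minimal forest0 xF; rewrite hx.
have := treeP i ni; rewrite inE => /and3P[_ _ /'forall_implyP/(_ x xF)].
rewrite hx /= => Nlx; suff Ei : i = i0 by rewrite Ei eqxx in ni.
apply: link_i => //.
rewrite part_remove_other 1?eq_sym //.
by move: forest0; rewrite inE => /andP[].
Qed.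

Lemma necklace_bead_inj F i0 i1 :
  (forall i, part F i \in bead i0 i) -> (forall i, part F i \in bead i1 i) ->
  i0 = i1.
Proof.
move=> F0 F1; apply/eqP/negPn/negP => n01.
have := F0 i0; have := F1 i0; rewrite /bead eqxx (negPf n01) !inE.
by case: links_ends; rewrite ?andbF.
Qed.

(** The constraint [Y] lets one count serve for both [tau] and [tau_edge]. *)
Lemma card_necklace_trees (Y : forall i, {set edge_set (r i)}) :
  #|[set F in spanning_trees N | [forall i, part F i \in Y i]]| =
  (\sum_i0 \prod_i #|bead i0 i :&: Y i|)%N.
Proof.
rewrite (_ : [set F in _ | _] = [set F : {set edge N} |
    [exists i0, [forall i, part F i \in bead i0 i :&: Y i]]]); last first.
  apply/setP => F; rewrite [LHS]in_set [RHS]in_set.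
  apply/andP/existsP => [[/necklace_treeP[i0 F0] /forallP FY]|[i0 /forallP F0]].
    by exists i0; apply/forallP => i; rewrite inE F0 FY.
  split; last by apply/forallP => i; have := F0 i; rewrite inE => /andP[].
  by apply/necklace_treeP; exists i0 => i; have := F0 i; rewrite inE => /andP[].
rewrite card_unique_witness => [|i0 i1 F /forallP F0 /forallP F1]; last first.
  by apply: (@necklace_bead_inj F) => i; [have := F0 i | have := F1 i];
    rewrite inE => /andP[].
apply: eq_bigr => i0 _.
exact: (card_set_parts (fun i => bead i0 i :&: Y i)).
Qed.

Lemma tau_necklace : tau N = (\sum_i0 \prod_i #|bead i0 i|)%N.
Proof.
transitivity #|[set F in spanning_trees N | [forall i, part F i \in setT]]|.
  apply: eq_card => F; rewrite [RHS]inE; case: (_ \in _) => //=.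
  by apply/esym/forallP => i; rewrite inE.
rewrite card_necklace_trees; apply: eq_bigr => i0 _; apply: eq_bigr => i _.
by rewrite setIT.
Qed.

Lemma tau_edge_necklace i1 (x : option ('I_(r i1) * bool)) :
  tau_edge (necklace_e x : edge N) =
  (\sum_i0 #|[set A in bead i0 i1 | x \in A]| *
            \prod_(i | i != i1) #|bead i0 i|)%N.
Proof.
(* The condition [x \in A] in bead [i1], vacuous in the others; comparing edges of the necklace
   makes it well typed for every [i]. *)
pose Y i : {set edge_set (r i)} :=
  [set A : edge_set (r i) |
    [forall y, (necklace_e y == necklace_e x :> edge N) ==> (y \in A)]].
transitivity #|[set F in spanning_trees N | [forall i, part F i \in Y i]]|.
  apply: eq_card => F; rewrite !inE; congr (_ && _).
  apply/idP/forallP => [xF i|/(_ i1)]; rewrite inE.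
    by apply/forallP => y; apply/implyP => /eqP Ey; rewrite inE Ey.
  by move=> /forallP/(_ x); rewrite eqxx inE.
rewrite card_necklace_trees; apply: eq_bigr => i0 _; rewrite (bigD1 i1) //=.
congr (_ * _)%N.
  apply: eq_card => A; rewrite !inE; congr (_ && _).
  apply/forallP/idP => [/(_ x)|xA y]; first by rewrite eqxx.
  by rewrite /necklace_e eq_Tagged /=; apply/implyP => /eqP->.
apply: eq_bigr => i ni; apply: eq_card => A; rewrite !inE.
case: (_ \in _) => //=; apply/forallP => y.
apply/implyP => /eqP/(congr1 tag) /= Ei.
by rewrite Ei eqxx in ni.
Qed.

End NecklaceTrees.

(** * Bead counts as multiples of the number of trees *)

Section Weights.
Variable r : nat.

(* The number of spanning forests of [H_r] with two components separating [u]
   from [v], divided by its number of spanning trees: see [pow2_weight]. *)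
Definition weight : rat := 2 / (r%:R + 2).

Lemma weight_gt0 : 0 < weight.
Proof. by rewrite divr_gt0 ?ltr0n // ltr_wpDl. Qed.

Lemma weight_le1 : weight <= 1.
Proof. by rewrite ler_pdivrMr ?mul1r ?lerDr ?ltr_wpDl. Qed.

Let r2_neq0 : r%:R + 2 != 0 :> rat.
Proof. by rewrite gt_eqF // ltr_wpDl. Qed.

Lemma bead_tree_neq0 : #|bead_tree r|%:R != 0 :> rat.
Proof.
rewrite pnatr_eq0 -lt0n; have := card_bead_tree r.
have : (0 < (r + 2) * 2 ^ r)%N by rewrite muln_gt0 addn2 expn_gt0.
by case: #|_| => // r_gt0 E; rewrite -E muln0 in r_gt0.
Qed.

Lemma pow2_weight : (2 ^ r)%:R = weight * #|bead_tree r|%:R :> rat.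
Proof.
have /(congr1 (fun k => k%:R : rat)) := card_bead_tree r.
rewrite !natrM natrD => E; rewrite /weight mulrAC E; field; exact: r2_neq0.
Qed.

Lemma bead_tree_edge_weight j b :
  #|[set A in bead_tree r | Some (j, b) \in A]|%:R =
  (1 / 2 + weight / 4) * #|bead_tree r|%:R :> rat.
Proof.
have /(congr1 (fun k => k%:R : rat)) := card_bead_tree_edge j b.
rewrite !natrM natrD pow2_weight => E.
have -> : 1 / 2 + weight / 4 = (r%:R + 3) * weight / 4.
  rewrite /weight; field; exact: r2_neq0.
by apply: (mulfI (x := 4)) => //; rewrite E; field.
Qed.

Lemma bead_forest_edge_weight j b :
  #|[set A in bead_forest r | Some (j, b) \in A]|%:R =
  weight / 2 * #|bead_tree r|%:R :> rat.
Proof.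
have /(congr1 (fun k => k%:R : rat)) := card_bead_forest_edge j b.
rewrite natrM pow2_weight => E.
by apply: (mulfI (x := 2)) => //; rewrite E; field.
Qed.

End Weights.

(** * Densities in terms of the weights *)

Section NecklaceDensity.
Variables (n : nat) (r : 'I_n -> nat).
Hypothesis n_gt0 : (0 < n)%N.
Let N := necklace_H r.
Let S : rat := \sum_i weight (r i).
Let trees : rat := \prod_i #|bead_tree (r i)|%:R.

Let trees_neq0 : trees != 0.
Proof. by apply/prodf_neq0 => i _; apply: bead_tree_neq0. Qed.

Let S_gt0 : 0 < S.
Proof.
rewrite /S (bigD1 (Ordinal n_gt0)) //= ltr_wpDr ?weight_gt0 //.
by apply: sumr_ge0 => i _; apply/ltW/weight_gt0.
Qed.

Lemma prod_bead i0 :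
  (\prod_i #|bead r i0 i|)%:R = trees * weight (r i0) :> rat.
Proof.
rewrite natr_prod (bigD1 i0) //= /trees [in RHS](bigD1 i0) //= mulrAC.
rewrite /bead eqxx card_bead_forest pow2_weight.
congr (_ * _); first exact: mulrC.
by apply: eq_bigr => i /negPf->.
Qed.

Lemma tau_weight : (tau N)%:R = trees * S.
Proof.
rewrite tau_necklace // natr_sum big_distrr; apply: eq_bigr => i _.
exact: prod_bead.
Qed.

(** Here [f] and [t] count the forests and trees of bead [i] through [x], relative to its trees. The
    term [f] comes from an unlinked bead [i], the rest from the other choices of that bead. *)
Lemma density_weight i (x : option ('I_(r i) * bool)) (f t : rat) :
  #|[set A in bead_forest (r i) | x \in A]|%:R = f * #|bead_tree (r i)|%:R ->
  #|[set A in bead_tree (r i) | x \in A]|%:R = t * #|bead_tree (r i)|%:R ->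
  density (necklace_e x : edge N) = (f + t * (S - weight (r i))) / S.
Proof.
move=> fE tE; rewrite /density tau_weight tau_edge_necklace //.
suff -> : (\sum_i0 #|[set A in bead r i0 i | x \in A]| *
            \prod_(k | k != i) #|bead r i0 k|)%N%:R =
          trees * (f + t * (S - weight (r i))).
  by rewrite -mulf_div divff ?mul1r.
rewrite natr_sum (bigD1 i) //= mulrDr; congr (_ + _).
  rewrite natrM natr_prod {1}/bead eqxx fE /trees [in RHS](bigD1 i) //=.
  rewrite mulrAC -mulrA mulrC; congr (_ * _); rewrite mulrC; congr (_ * _).
  by apply: eq_bigr => k; rewrite /bead => /negPf->.
have -> : S - weight (r i) = \sum_(k | k != i) weight (r k).
  by rewrite /S (bigD1 i) //= addrAC subrr add0r.
rewrite mulrCA !big_distrr /=; apply: eq_bigr => i0 ni0.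
rewrite -prod_bead natrM [in RHS](bigD1 i) //= natrM mulrA; congr (_ * _).
by rewrite /bead eq_sym (negPf ni0).
Qed.

End NecklaceDensity.

(** * Bounds on the densities and their maximum *)

Lemma uv_edge_bound (w s : rat) : w <= 1 -> w <= s - 1 -> w * (s - w) <= s - 1.
Proof.
move=> w_le1 w_le; have : 0 <= (1 - w) * (s - 1 - w) by apply: mulr_ge0; lra.
lra.
Qed.

Lemma path_edge_bound (w s : rat) :
  w <= 1 -> w <= s - 2 -> w / 2 + (1 / 2 + w / 4) * (s - w) <= s - 1.
Proof.
(* This product is four times the right side minus the left side. *)
move=> w_le1 w_le; have : 0 <= (2 - w) * (s - 2 - w) by apply: mulr_ge0; lra.
lra.
Qed.

(** Cleared of denominators, hypothesis and conclusion both say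
    [2 * (q - p) <= (2 * p - q) * (x + 2)]. *)
Lemma weight_bound (p q x : rat) : 0 <= x -> q / 2 < p -> p < q ->
  (4 * q - 6 * p) / (2 * p - q) <= x -> 2 / (x + 2) <= q / (q - p) - 2.
Proof.
move=> x_ge0 p_gt p_lt; rewrite ler_pdivrMr; last by lra.
have -> : q / (q - p) - 2 = (2 * p - q) / (q - p) by field; lra.
move=> x_ge; rewrite ler_pdivrMr; last by lra.
rewrite mulrAC ler_pdivlMr; lra.
Qed.

(* The index i : 'I_n stands for i + 1 in 1, ..., n; only r 2, ..., r n are
   used. *)
Theorem theorem3p10 (p q n : nat) (r : nat -> nat)
    (p_gt0 : (0 < p)%N) (q_gt0 : (0 < q)%N) (n_ge2 : (2 <= n)%N)
    (hpq : q%:R / 2 < p%:R :> rat) (p_lt_q : (p < q)%N)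
    (r_sum : \sum_(2 <= i < n.+1) (2 / ((r i)%:R + 2)) =
             p%:R / (q%:R - p%:R) :> rat)
    (r_ge : forall i : nat, (2 <= i <= n)%N ->
       (4 * q%:R - 6 * p%:R) / (2 * p%:R - q%:R) <= (r i)%:R :> rat) :
  dep (necklace_H (fun i : 'I_n => if i == 0%N :> nat then 0%N else r i.+1))
  = p%:R / q%:R.
Proof.
set r' := fun i : 'I_n => _.
have n_gt0 : (0 < n)%N by apply: leq_trans n_ge2.
have p0 : 0 < p%:R :> rat by rewrite ltr0n.
have pq : p%:R < q%:R :> rat by rewrite ltr_nat.
set P : rat := p%:R in hpq r_sum r_ge p0 pq *.
set Q : rat := q%:R in hpq r_sum r_ge pq *.
pose S : rat := \sum_i weight (r' i).
(* The bead [H_0] has weight [2 / (0 + 2) = 1]. *)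
have S_split : S = 1 + \sum_(i < n | i != Ordinal n_gt0) weight (r' i).
  by rewrite /S (bigD1 (Ordinal n_gt0)).
have SE : S = Q / (Q - P).
  have -> : S = 1 + P / (Q - P); last by field; lra.
  rewrite -r_sum /S; case: (n) n_gt0 @r' {S S_split} => // m _ r' /=.
  rewrite big_ord_recl; congr (_ + _).
  by rewrite big_add1 big_add1 big_mkord; apply: eq_bigr.
have S_gt0 : 0 < S by rewrite SE divr_gt0; lra.
have PQE : P / Q = (S - 1) / S by rewrite SE; field; lra.
rewrite PQE.
have S_weight (i : 'I_n) : i != Ordinal n_gt0 -> weight (r' i) <= S - 1.
  move=> ni; rewrite S_split addrAC subrr add0r (bigD1 i) //= lerDl.
  by apply: sumr_ge0 => k _; apply/ltW/weight_gt0.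
pose uv (i : 'I_n) : edge (necklace_H r') :=
  necklace_e (None : option ('I_(r' i) * bool)).
have density_uv i :
    density (uv i) = weight (r' i) * (S - weight (r' i)) / S.
  rewrite (density_weight n_gt0 (f := 0) (t := weight (r' i))) ?add0r //.
    by rewrite card_bead_forest_uv mul0r.
  by rewrite card_bead_tree_uv pow2_weight.
apply/le_anti/andP; split; last first.
  (* The maximum is attained at the single edge of [H_0]. *)
  have -> : (S - 1) / S = density (uv (Ordinal n_gt0)).
    by rewrite density_uv mul1r.
  exact: le_bigmax.
apply: bigmax_le => [|[i [[j b]|]] _].
(* The default value 0 of the maximum must also lie below the bound. *)
- by rewrite -PQE divr_ge0; lra.
(* [H_0] has no path edges, so bead [i] is one of those covered by [r_ge]. *)
- have ri_gt0 : (0 < r' i)%N := leq_ltn_trans (leq0n _) (ltn_ord j).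
  have ni : i != Ordinal n_gt0 by apply: contraTneq ri_gt0 => ->.
  have -> := density_weight n_gt0 (bead_forest_edge_weight j b)
                                  (bead_tree_edge_weight j b).
  rewrite ler_pM2r ?invr_gt0 // -/S.
  apply: path_edge_bound; first exact: weight_le1.
  have i_gt0 : (0 < i)%N by rewrite lt0n.
  have i_range : (2 <= i.+1 <= n)%N by rewrite !ltnS i_gt0 ltn_ord.
  have r'E : r' i = r i.+1 by rewrite /r' ifN // -lt0n.
  rewrite SE /weight r'E.
  exact: (weight_bound (ler0n _ _) hpq pq (r_ge _ i_range)).
- have -> := density_uv i.
  rewrite ler_pM2r ?invr_gt0 //.
  have [->|ni] := eqVneq i (Ordinal n_gt0); first by rewrite mul1r.
  by apply: uv_edge_bound; [apply: weight_le1 | apply: S_weight].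
Qed.
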